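(* Let $\mathbb{P}$, $\mathbb{P}'$ be partial fields such that $\mathbb{P}=\mathbb{P}[\mathcal{F}(\mathbb{P})]$ and $\mathbb{P}'=\mathbb{P}'[\mathcal{F}(\mathbb{P}')]$, and suppose $\phi:\mathbb{P}\to\mathbb{P}'$ is a partial field homomorphism. Then there exist commutative rings $R$, $R'$ and sets $S\subseteq R^*$, $S'\subseteq (R')^*$ such that $\mathbb{P}\cong\mathbb{P}(R,S)$, $\mathbb{P}'\cong\mathbb{P}(R',S')$, and such that (under these identifications) $\phi$ extends to a ring homomorphism $\phi':R\to R'$.
   Context: A partial field is a tuple $\mathbb{P}=(P,+,\cdot,0,1)$ with $\cdot$ a binary and $+$ a partial binary operation satisfying: (P1) $(P\setminus\{0\},\cdot,1)$ is an abelian group, $\mathbb{P}^*$; (P2) $p+0=p$; (P3) unique additive inverses $-p$; (P4) commutativity of defined sums; (P5) $p(q+r)$ defined iff $pq+pr$ defined, then equal; (P6) the associative law (for a finite multiset admitting an association, i.e. a binary-tree evaluation of its sum by defined pairwise sums, every other binary tree whose non-root internal sums are defined has root sum defined and equal to the same value). A homomorphism $\phi$ satisfies $\phi(pq)=\phi(p)\phi(q)$ and $\phi(p)+\phi(q)\doteq\phi(p+q)$ whenever $p+q$ is defined ($\doteq$: defined and equal). An isomorphism is a bijective homomorphism $\phi$ such that $\phi(p)+\phi(q)$ is defined iff $p+q$ is defined. $\mathcal{F}(\mathbb{P})=\{p\in\mathbb{P}:1-p\in\mathbb{P}\}$ (fundamental elements). For $S\subseteq\mathbb{P}^*$, $\mathbb{P}[S]$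 is the partial field with underlying set $\langle S\cup\{-1\}\rangle\cup\{0\}$ (multiplicative subgroup generated, plus $0$) with the operations of $\mathbb{P}$ restricted (a sum is defined only if its value in $\mathbb{P}$ lies in this set); $\mathbb{P}=\mathbb{P}[\mathcal{F}(\mathbb{P})]$ means the nonzero fundamental elements together with $-1$ generate $\mathbb{P}^*$. For a commutative ring $R$ and $S\subseteq R^*$, $\mathbb{P}(R,S)$ has underlying set $\langle S\cup\{-1\}\rangle\cup\{0\}$, multiplication of $R$, and $p+q$ defined iff the ring sum lies in this set. *)

(* Defs.v *)
From HB Require Import structures.
From mathcomp Require Import all_boot all_order all_algebra.
From mathcomp Require Import boolp classical_sets.

Set Implicit Arguments.
Unset Strict Implicit.
Unset Printing Implicit Defensive.

Import GRing.Theory.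
Local Open Scope classical_set_scope.
Local Open Scope ring_scope.

(* Subgroup of units generated by A, inside a commutative monoid.  As a partial
   field has no inverse operation, [y] is an inverse of [x] when x y = 1. *)
Inductive generated (T : Type) (one : T) (mul : T -> T -> T) (A : set T) :
    set T :=
| Gen_mem x : A x -> generated one mul A x
| Gen_one : generated one mul A one
| Gen_mul x y : generated one mul A x -> generated one mul A y ->
    generated one mul A (mul x y)
| Gen_inv x y : generated one mul A x -> mul x y = one ->
    generated one mul A y.

(* Binary trees with leaves labelled by the elements of a multiset. *)
Inductive assoc_tree (T : Type) : Type :=
| Leaf of T
| Node of assoc_tree T & assoc_tree T.

Arguments Leaf {T}.
Arguments Node {T}.

Fixpoint leaves (T : Type) (t : assoc_tree T) : seq T :=
  match t with
  | Leaf x => [:: x]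
  | Node l r => leaves l ++ leaves r
  end.

(* [tree_sum add t = Some v]: the sum at every internal node of [t] is defined,
   and the value at the root is [v]. *)
Fixpoint tree_sum (T : Type) (add : T -> T -> option T) (t : assoc_tree T) :
    option T :=
  match t with
  | Leaf x => Some x
  | Node l r =>
      obind (fun a => obind (fun b => add a b) (tree_sum add r))
        (tree_sum add l)
  end.

(* [pfadd p q = None] means that p + q is undefined.
   - The group laws of the nonzero elements are stated for all elements, which
     is the same because of [pfmul0p].  Closure of the nonzero elements under
     multiplication follows from [pfmulpV] and [pfmul0p].
   - In [pfmulDr] p is nonzero: as 0 q + 0 r = 0 is always defined, the
     equivalence for p = 0 would make every sum q + r defined.
   - In [pfaddA], [Node l r] is the second tree, whose sums are assumed to be
     defined except at the root.  (A second tree that is a single leaf has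
     nothing to prove.) *)
HB.mixin Record isPartialField T of Choice T := {
  pf0 : T;
  pf1 : T;
  pfmul : T -> T -> T;
  pfadd : T -> T -> option T;
  pfopp : T -> T;
  pf1_neq0 : pf1 != pf0;
  pfmulA : associative pfmul;
  pfmulC : commutative pfmul;
  pfmul1p : left_id pf1 pfmul;
  pfmulpV : forall p, p != pf0 -> exists q, pfmul p q = pf1;
  pfmul0p : left_zero pf0 pfmul;
  pfaddp0 : forall p, pfadd p pf0 = Some p;
  pfaddpN : forall p, pfadd p (pfopp p) = Some pf0;
  pfopp_unique : forall p q, pfadd p q = Some pf0 -> q = pfopp p;
  pfaddC : forall p q r, pfadd p q = Some r -> pfadd q p = Some r;
  pfmulDr : forall p q r, p != pf0 ->
    pfadd (pfmul p q) (pfmul p r) = omap (pfmul p) (pfadd q r);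
  pfaddA : forall (t l r : assoc_tree T) (v : T),
    tree_sum pfadd t = Some v ->
    perm_eq (leaves t) (leaves (Node l r)) ->
    tree_sum pfadd l -> tree_sum pfadd r ->
    tree_sum pfadd (Node l r) = Some v
}.

#[short(type="partialFieldType")]
HB.structure Definition PartialField := {T of isPartialField T & Choice T}.

(* The zero map is a homomorphism in this sense.  It has no extension to a
   unital ring homomorphism R -> R' when 1 <> 0 in R'; any other homomorphism maps 1 to 1. *)
Definition pf_hom (P Q : partialFieldType) (phi : P -> Q) : Prop :=
  (forall p q, phi (pfmul p q) = pfmul (phi p) (phi q)) /\
  (forall p q r, pfadd p q = Some r ->
     pfadd (phi p) (phi q) = Some (phi r)).

Definition pf_iso (P Q : partialFieldType) (phi : P -> Q) : Prop :=
  [/\ pf_hom phi, bijective phi &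
      forall p q, isSome (pfadd (phi p) (phi q)) <-> isSome (pfadd p q)].

Definition fundamental (P : partialFieldType) : set P :=
  [set p | isSome (pfadd pf1 (pfopp p))].

(* The underlying set of the partial field P[S]. *)
Definition subpf (P : partialFieldType) (S : set P) : set P :=
  generated pf1 pfmul (S `|` [set pfopp pf1]) `|` [set pf0].

(* P = P[F(P)]; the operations of P[F(P)] are those of P restricted, so this
   is equality of the underlying sets. *)
Definition fundamentally_generated (P : partialFieldType) : Prop :=
  subpf (@fundamental P `\ pf0) = [set: P].

Definition units (R : comUnitRingType) : set R :=
  [set x | x \is a GRing.unit].

Definition ringpf_set (R : comUnitRingType) (S : set R) : set R :=
  generated 1 *%R (S `|` [set -1]) `|` [set 0].

(* The carrier of P(R, S); the sum of x and y, [ringpf_add] below, is defined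
   when their sum in R lies in [ringpf_set S]. *)
Record ringpf (R : comUnitRingType) (S : set R) (hS : S `<=` @units R) :=
  RingPF { ringpf_val : R; ringpf_valP : ringpf_val \in ringpf_set S }.

Section RingPartialField.
Variables (R : comUnitRingType) (S : set R) (hS : S `<=` @units R).
Local Notation A := (ringpf_set S).
Local Notation T := (ringpf hS).

HB.instance Definition _ := [isSub for @ringpf_val R S hS].
HB.instance Definition _ := [Choice of T by <:].

Lemma generated_unit (x : R) :
  generated 1 *%R (S `|` [set -1]) x -> x \is a GRing.unit.
Proof.
elim=> {x} [x [Sx|->]||x y _ ux _ uy|x y _ ux xy].
- exact: hS.
- by rewrite unitrN unitr1.
- exact: unitr1.
- by rewrite unitrM ux uy.
- by apply/unitrP; exists x; rewrite xy mulrC.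
Qed.

Lemma ringpf0_subproof : 0 \in A.
Proof. by rewrite inE; right. Qed.

Lemma ringpf1_subproof : 1 \in A.
Proof. by rewrite inE; left; exact: Gen_one. Qed.

Lemma ringpfM_subproof (x y : R) : x \in A -> y \in A -> x * y \in A.
Proof.
rewrite !inE => -[gx|->]; last by rewrite mul0r; right.
case=> [gy|->]; last by rewrite mulr0; right.
by left; exact: Gen_mul.
Qed.

Lemma ringpfN_subproof (x : R) : x \in A -> - x \in A.
Proof.
move=> Ax; rewrite -mulN1r; apply: ringpfM_subproof => //.
by rewrite inE; left; apply: Gen_mem; right.
Qed.

Lemma ringpfV_subproof (x : R) : x \in A -> x^-1 \in A.
Proof.
rewrite !inE => -[gx|->]; last by rewrite invr0; right.
by left; apply: (Gen_inv gx); rewrite mulrV ?generated_unit.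
Qed.

Definition ringpf0 : T := RingPF hS ringpf0_subproof.
Definition ringpf1 : T := RingPF hS ringpf1_subproof.
Definition ringpf_mul (x y : T) : T :=
  RingPF hS (ringpfM_subproof (valP x) (valP y)).
Definition ringpf_opp (x : T) : T :=
  RingPF hS (ringpfN_subproof (valP x)).
Definition ringpf_add (x y : T) : option T := insub (val x + val y).

Lemma ringpf_addE (x y z : T) :
  ringpf_add x y = Some z <-> val x + val y = val z.
Proof.
rewrite /ringpf_add; split=> [|->]; last by rewrite valK.
by case: insubP => // u _ <- [->].
Qed.

Lemma ringpf_unit (x : T) : x != ringpf0 -> val x \is a GRing.unit.
Proof.
move: (valP x); rewrite inE => -[/generated_unit //|x0 /eqP[]].
exact: val_inj.
Qed.

Lemma ringpf_tree_sum (t : assoc_tree T) (v : T) :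
  tree_sum ringpf_add t = Some v -> val v = \sum_(x <- leaves t) val x.
Proof.
elim: t v => [x|l IHl r IHr] v /=; first by case=> ->; rewrite big_seq1.
case: (tree_sum _ l) IHl => //= a /(_ a erefl) al.
case: (tree_sum _ r) IHr => //= b /(_ b erefl) br.
by move/ringpf_addE <-; rewrite big_cat /= -al -br.
Qed.

Fact ringpf1_neq0 : ringpf1 != ringpf0.
Proof. by apply/eqP => /(congr1 val)/eqP; rewrite oner_eq0. Qed.

Fact ringpf_mulA : associative ringpf_mul.
Proof. by move=> x y z; apply: val_inj; rewrite /= mulrA. Qed.

Fact ringpf_mulC : commutative ringpf_mul.
Proof. by move=> x y; apply: val_inj; rewrite /= mulrC. Qed.

Fact ringpf_mul1p : left_id ringpf1 ringpf_mul.
Proof. by move=> x; apply: val_inj; rewrite /= mul1r. Qed.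

Fact ringpf_mulpV (x : T) : x != ringpf0 -> exists y, ringpf_mul x y = ringpf1.
Proof.
move=> /ringpf_unit ux; exists (RingPF hS (ringpfV_subproof (valP x))).
by apply: val_inj; rewrite /= mulrV.
Qed.

Fact ringpf_mul0p : left_zero ringpf0 ringpf_mul.
Proof. by move=> x; apply: val_inj; rewrite /= mul0r. Qed.

Fact ringpf_addp0 (x : T) : ringpf_add x ringpf0 = Some x.
Proof. by apply/ringpf_addE; rewrite /= addr0. Qed.

Fact ringpf_addpN (x : T) : ringpf_add x (ringpf_opp x) = Some ringpf0.
Proof. by apply/ringpf_addE; rewrite /= subrr. Qed.

Fact ringpf_opp_unique (x y : T) :
  ringpf_add x y = Some ringpf0 -> y = ringpf_opp x.
Proof.
move=> /ringpf_addE /= /eqP; rewrite addrC addr_eq0 => /eqP yx.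
exact: val_inj.
Qed.

Fact ringpf_addC (x y z : T) :
  ringpf_add x y = Some z -> ringpf_add y x = Some z.
Proof. by rewrite !ringpf_addE addrC. Qed.

Fact ringpf_mulDr (x y z : T) : x != ringpf0 ->
  ringpf_add (ringpf_mul x y) (ringpf_mul x z) =
  omap (ringpf_mul x) (ringpf_add y z).
Proof.
move=> /ringpf_unit ux; case yz: (ringpf_add y z) => [s|] /=.
  by apply/ringpf_addE; move/ringpf_addE: yz => /= <-; rewrite mulrDr.
case xyz: (ringpf_add _ _) => [s|//].
move/ringpf_addE: xyz => /=; rewrite -mulrDr => xyz.
have sP : (val x)^-1 * val s \in A.
  exact: ringpfM_subproof (ringpfV_subproof (valP x)) (valP s).
suff : ringpf_add y z = Some (RingPF hS sP) by rewrite yz.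
by apply/ringpf_addE; rewrite /= -xyz mulKr.
Qed.

Fact ringpf_addA (t l r : assoc_tree T) (v : T) :
  tree_sum ringpf_add t = Some v ->
  perm_eq (leaves t) (leaves (Node l r)) ->
  tree_sum ringpf_add l -> tree_sum ringpf_add r ->
  tree_sum ringpf_add (Node l r) = Some v.
Proof.
move=> /ringpf_tree_sum tv tlr /=.
case lE: (tree_sum _ l) => [a|//] _; case rE: (tree_sum _ r) => [b|//] _ /=.
apply/ringpf_addE; rewrite tv (perm_big _ tlr) /= big_cat /=.
by rewrite (ringpf_tree_sum lE) (ringpf_tree_sum rE).
Qed.

HB.instance Definition _ := isPartialField.Build T
  ringpf1_neq0 ringpf_mulA ringpf_mulC ringpf_mul1p ringpf_mulpV ringpf_mul0p
  ringpf_addp0 ringpf_addpN ringpf_opp_unique ringpf_addC ringpf_mulDr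
  ringpf_addA.

End RingPartialField.

(* Main.v *)
(* Let R be Z[P] modulo the relations [p] + [q] = [p + q] over all sums defined
   in P; then every homomorphism of partial fields induces a ring homomorphism.
   Since -[p] = [-p], an element of R is given by a multiset over P, and it
   vanishes when, after adding pairs {u, -u}, the multiset has an association
   with value 0.  The associative law then shows that [p] + [q] = [r] holds in R
   only if p + q = r in P, hence P is isomorphic to P(R, S) for S the image of
   the nonzero elements of P. *)

Require Import Defs.
From HB Require Import structures.
From mathcomp Require Import all_boot all_order all_algebra zify.
From mathcomp Require Import boolp classical_sets.

Set Implicit Arguments.
Unset Strict Implicit.
Unset Printing Implicit Defensive.

Import GRing.Theory.
Local Open Scope classical_set_scope.
Local Open Scope ring_scope.
Local Open Scope quotient_scope.

(** * Elementary consequences of the axioms of a partial field *)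

Section PartialFieldTheory.
Variable P : partialFieldType.
Implicit Types p q r x y : P.

Lemma pfmulp0 p : pfmul p pf0 = pf0.
Proof. by rewrite pfmulC pfmul0p. Qed.

Lemma pfmulp1 p : pfmul p pf1 = p.
Proof. by rewrite pfmulC pfmul1p. Qed.

Lemma pfoppK : involutive (@pfopp P).
Proof. by move=> p; rewrite -(pfopp_unique _ _ (pfaddC _ _ _ (pfaddpN p))). Qed.

Lemma pfopp0 : pfopp pf0 = pf0 :> P.
Proof. by rewrite -(pfopp_unique _ _ (pfaddp0 pf0)). Qed.

Lemma pfadd0p p : pfadd pf0 p = Some p.
Proof. exact/pfaddC/pfaddp0. Qed.

(** Regrouping (p + p) + (-p) = 0 as p + (p + (-p)) gives p = 0. *)
Lemma pfadd_idem p : pfadd p p = Some p -> p = pf0.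
Proof.
move=> pp; pose t := Node (Node (Leaf p) (Leaf p)) (Leaf (pfopp p)).
have tE : tree_sum pfadd t = Some pf0 by rewrite /= pp /= pfaddpN.
have /= := @pfaddA P _ (Leaf p) (Node (Leaf p) (Leaf (pfopp p))) _ tE.
by rewrite pfaddpN /= pfaddp0 => /(_ (perm_refl _) isT isT) [].
Qed.

Lemma pfmulpN p q : pfmul p (pfopp q) = pfopp (pfmul p q).
Proof.
have [->|p0] := eqVneq p pf0; first by rewrite !pfmul0p pfopp0.
by apply: pfopp_unique; rewrite pfmulDr // pfaddpN /= pfmulp0.
Qed.

Lemma pfmulNp p q : pfmul (pfopp p) q = pfopp (pfmul p q).
Proof. by rewrite pfmulC pfmulpN pfmulC. Qed.

End PartialFieldTheory.

(** * Maps that preserve defined sums *)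

Fixpoint tree_map (T U : Type) (f : T -> U) (t : assoc_tree T) : assoc_tree U :=
  match t with
  | Leaf x => Leaf (f x)
  | Node l r => Node (tree_map f l) (tree_map f r)
  end.

Lemma leaves_map (T U : Type) (f : T -> U) t :
  leaves (tree_map f t) = map f (leaves t).
Proof. by elim: t => //= l -> r ->; rewrite map_cat. Qed.

(** The additive half of [pf_hom] is isolated so that it also covers negation and multiplication by
    a fixed element, which are not multiplicative in general. *)
Definition sum_morph (P Q : partialFieldType) (f : P -> Q) : Prop :=
  forall p q r, pfadd p q = Some r -> pfadd (f p) (f q) = Some (f r).

Section SumMorphisms.
Variables (P Q : partialFieldType) (f : P -> Q).
Hypothesis fD : sum_morph f.

Lemma sum_morph0 : f pf0 = pf0.
Proof. exact/pfadd_idem/fD/pfaddp0. Qed.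

Lemma sum_morphN p : f (pfopp p) = pfopp (f p).
Proof. by apply: pfopp_unique; rewrite -sum_morph0; apply/fD/pfaddpN. Qed.

Lemma tree_sum_map t v :
  tree_sum pfadd t = Some v -> tree_sum pfadd (tree_map f t) = Some (f v).
Proof.
elim: t v => [x|l IHl r IHr] v /=; first by case=> ->.
case: (tree_sum _ l) IHl => //= a /(_ a erefl) ->.
by case: (tree_sum _ r) IHr => //= b /(_ b erefl) -> /fD.
Qed.

End SumMorphisms.

Lemma sum_morph_mul (P : partialFieldType) (p : P) : sum_morph (pfmul p).
Proof.
move=> x y z xyz; have [->|p0] := eqVneq p pf0.
  by rewrite !pfmul0p pfaddp0.
by rewrite pfmulDr // xyz.
Qed.

(** * Multisets that vanish after adding cancelling pairs *)

Section NullMultisets.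
Variable P : partialFieldType.
Implicit Types (p q r : P) (s t u : seq P).

Definition opps s := map (@pfopp P) s.

(* The multisets that vanish in the universal ring of [P]. *)
Definition null s : Prop := exists u (w : assoc_tree P),
  perm_eq (leaves w) (s ++ u ++ opps u) /\ tree_sum pfadd w = Some pf0.

Lemma oppsK : involutive opps.
Proof. by apply: mapK => p; apply: pfoppK. Qed.

Lemma opps_cat s t : opps (s ++ t) = opps s ++ opps t.
Proof. exact: map_cat. Qed.

(** Each pair is summed to 0 on its own before it is attached, so every partial sum is defined and
    the value stays p. *)
Lemma pairs_tree p u : exists t : assoc_tree P,
  tree_sum pfadd t = Some p /\ perm_eq (leaves t) (p :: u ++ opps u).
Proof.
elim: u => [|x u [t [tp tu]]]; first by exists (Leaf p).
exists (Node t (Node (Leaf x) (Leaf (pfopp x)))); split.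
  by rewrite /= tp /= pfaddpN /= pfaddp0.
apply/permP => a; move/permP: tu => /(_ a).
by rewrite /= !count_cat /= ?count_cat /= => ->; lia.
Qed.

Lemma null_perm s t : perm_eq s t -> null s -> null t.
Proof.
move=> st [u [w [wE w0]]]; exists u, w; split=> //.
by rewrite (perm_trans wE) // perm_cat2r.
Qed.

Lemma null_cat s t : null s -> null t -> null (s ++ t).
Proof.
move=> [u [w [wE w0]]] [u' [w' [wE' w0']]].
exists (u ++ u'), (Node w w'); split; last by rewrite /= w0 w0' /= pfaddp0.
apply/permP => a; move/permP: wE => /(_ a); move/permP: wE' => /(_ a).
by rewrite /opps map_cat /= !count_cat => -> ->; lia.
Qed.

Lemma null_cancel s u : null (s ++ u ++ opps u) -> null s.
Proof.
move=> [u' [w [wE w0]]]; exists (u ++ u'), w; split=> //.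
apply/permP => a; move/permP: wE => /(_ a).
by rewrite opps_cat !count_cat => ->; lia.
Qed.

Lemma null_leaves (t : assoc_tree P) :
  tree_sum pfadd t = Some pf0 -> null (leaves t).
Proof.
move=> t0; exists [:: pf0], (Node t (Node (Leaf pf0) (Leaf pf0))).
by rewrite /= t0 /= !pfaddp0 /= pfaddp0 pfopp0.
Qed.

Lemma null0 : null [:: pf0].
Proof. exact: (@null_leaves (Leaf pf0)). Qed.

Lemma null_pairs u : null (u ++ opps u).
Proof.
have [t [t0 tE]] := pairs_tree pf0 u.
(* The tree has an extra leaf 0; [null0] supplies a second one, and the two form a pair {0, -0} that
   cancels. *)
apply: (@null_cancel _ [:: pf0]).
apply: null_perm (null_cat (null_leaves t0) null0).
apply/permP => a; move/permP: tE => /(_ a).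
by rewrite /= !count_cat /= pfopp0 => ->; lia.
Qed.

Lemma null_nil : null [::].
Proof. exact: (@null_cancel _ [::]) (null_pairs [::]). Qed.

(** The faithfulness of the construction: a three-term relation of the ring already holds in [P]. *)
Lemma null_triple p q r : null [:: p; q; pfopp r] -> pfadd p q = Some r.
Proof.
move=> [u [t [tE t0]]].
(* Attaching [r] to [t] turns [pfopp r] into a member of a cancelling pair, so
   that the pairs can be absorbed by [p] alone. *)
have [l [lp lE]] := pairs_tree p (pfopp r :: u).
have /= := @pfaddA P (Node t (Leaf r)) l (Leaf q) r.
rewrite t0 lp /= pfadd0p; apply => //.
apply/permP => a; move/permP: tE => /(_ a); move/permP: lE => /(_ a).
by rewrite /= !count_cat /= ?count_cat /= pfoppK => -> ->; lia.
Qed.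

Lemma null_sum p q r : pfadd p q = Some r -> null [:: p; q; pfopp r].
Proof.
move=> pq.
apply: (@null_leaves (Node (Node (Leaf p) (Leaf q)) (Leaf (pfopp r)))).
by rewrite /= pq /= pfaddpN.
Qed.

End NullMultisets.

Lemma map_opps (P Q : partialFieldType) (f : P -> Q) s : sum_morph f ->
  map f (opps s) = opps (map f s).
Proof.
move=> fD; rewrite /opps -!map_comp; apply: eq_map => x /=.
exact: sum_morphN.
Qed.

(** A map preserving sums carries zero-sum trees to zero-sum trees and cancelling pairs to
    cancelling pairs. Negation, products and functoriality in the ring all rest on this. *)
Lemma null_map (P Q : partialFieldType) (f : P -> Q) s : sum_morph f ->
  null s -> null (map f s).
Proof.
move=> fD [u [t [tE t0]]]; exists (map f u), (tree_map f t).
rewrite leaves_map (tree_sum_map fD t0) sum_morph0 // -map_opps // -!map_cat.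
by split=> //; apply: perm_map.
Qed.

(** * The universal ring as a quotient of multisets *)

Section UniversalRing.
Variable P : partialFieldType.
Implicit Types (p q r : P) (s t u : seq P).

Definition eqv s t : bool := `[< null (s ++ opps t) >].

Lemma eqvP s t : reflect (null (s ++ opps t)) (eqv s t).
Proof. exact: asboolP. Qed.

Lemma perm_eqv s t : perm_eq s t -> eqv s t.
Proof.
move=> st; apply/eqvP; apply: null_perm (null_pairs s).
by rewrite perm_cat2l perm_map.
Qed.

Lemma eqv_refl : reflexive eqv.
Proof. by move=> s; apply: perm_eqv. Qed.

(** Negation is multiplication by -1. *)
Lemma opp_sum_morph : sum_morph (@pfopp P).
Proof.
move=> p q r /(@sum_morph_mul _ (pfopp pf1)).
by rewrite !pfmulNp !pfmul1p.
Qed.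

Lemma null_opps s : null s -> null (opps s).
Proof. exact/null_map/opp_sum_morph. Qed.

Lemma eqv_symW s t : eqv s t -> eqv t s.
Proof.
move=> /eqvP /null_opps; rewrite opps_cat oppsK => st.
by apply/eqvP; apply: null_perm st; rewrite perm_catC.
Qed.

Lemma eqv_sym : symmetric eqv.
Proof. by move=> s t; apply/idP/idP; apply: eqv_symW. Qed.

(** In the union of the two formal differences the middle multiset meets its negative, and these
    pairs cancel. *)
Lemma eqv_trans : transitive eqv.
Proof.
move=> t s u /eqvP st /eqvP tu; apply/eqvP; apply: (@null_cancel _ _ t).
apply: null_perm (null_cat st tu).
by apply/permP => a; rewrite !count_cat; lia.
Qed.

Canonical eqv_equiv := EquivRel eqv eqv_refl eqv_sym eqv_trans.

(* Z[P] modulo the sums that are defined in [P], a formal sum being represented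
   by the multiset of its terms (the term -[p] being [-p]). *)
Definition uring : Type := {eq_quot eqv}.
HB.instance Definition _ := Choice.on uring.

Definition cls s : uring := \pi_({eq_quot eqv}) s.
Definition rep (x : uring) : seq P := repr (x : {eq_quot eqv}).

Lemma repK x : cls (rep x) = x.
Proof. exact: reprK. Qed.

Lemma clsP s t : cls s = cls t <-> null (s ++ opps t).
Proof. by split=> [/eqmodP /eqvP|/eqvP ?]; last apply/eqmodP. Qed.

Lemma cls_perm s t : perm_eq s t -> cls s = cls t.
Proof. by move=> /perm_eqv st; apply/clsP/eqvP. Qed.

Lemma cls_ind (A : uring -> Prop) : (forall s, A (cls s)) -> forall x, A x.
Proof. by move=> Acls x; rewrite -(repK x). Qed.

Lemma cls_rep s : null (rep (cls s) ++ opps s).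
Proof. by apply/clsP; rewrite repK. Qed.

Definition muls s t := [seq pfmul x y | x <- s, y <- t].

Lemma muls_consl x s t : muls (x :: s) t = map (pfmul x) t ++ muls s t.
Proof. exact: allpairs_cons. Qed.

Lemma perm_muls_consr s x t :
  perm_eq (muls s (x :: t)) (map (pfmul x) s ++ muls s t).
Proof.
have -> : map (pfmul x) s = [seq pfmul y x | y <- s].
  by apply: eq_map => y; apply: pfmulC.
by rewrite /muls perm_allpairs_consr.
Qed.

Lemma perm_mulsC s t : perm_eq (muls s t) (muls t s).
Proof.
elim: s => [|x s IH]; first by rewrite /muls allpairs0r.
rewrite perm_sym (perm_trans (perm_muls_consr _ _ _)) // muls_consl.
by rewrite perm_cat2l perm_sym.
Qed.

Lemma muls_catl s t u : muls (s ++ t) u = muls s u ++ muls t u.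
Proof. exact: allpairs_cat. Qed.

Lemma mulsA s t u : muls s (muls t u) = muls (muls s t) u.
Proof.
elim: s => //= x s IH; rewrite !muls_consl muls_catl IH; congr (_ ++ _).
rewrite /muls map_allpairs allpairs_mapl; apply: eq_allpairs => y z.
exact: pfmulA.
Qed.

Lemma opps_muls s t : opps (muls s t) = muls (opps s) t.
Proof.
rewrite /opps /muls map_allpairs allpairs_mapl.
by apply: eq_allpairs => x y; rewrite pfmulNp.
Qed.

(** The product is the union of the multiples of s by the elements of t, and each multiple is null
    because multiplication by a fixed element preserves sums. *)
Lemma null_muls s t : null s -> null (muls s t).
Proof.
move=> s0; elim: t => [|y t IH].
  by rewrite /muls allpairs0r; apply: null_nil.
apply: (null_perm (s := map (pfmul y) s ++ muls s t)).
  by rewrite perm_sym perm_muls_consr.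
by apply: null_cat => //; apply: null_map => //; apply: sum_morph_mul.
Qed.

(** The operations use chosen representatives; [cls_cat], [cls_opps] and [cls_muls] show that the
    choice does not matter. *)
Definition uadd x y := cls (rep x ++ rep y).
Definition uopp x := cls (opps (rep x)).
Definition umul x y := cls (muls (rep x) (rep y)).

Lemma cls_cat s t : uadd (cls s) (cls t) = cls (s ++ t).
Proof.
apply/clsP; rewrite opps_cat.
apply: null_perm (null_cat (cls_rep s) (cls_rep t)).
by apply/permP => a; rewrite !count_cat; lia.
Qed.

Lemma cls_opps s : uopp (cls s) = cls (opps s).
Proof. by apply/clsP; rewrite -opps_cat; apply/null_opps/cls_rep. Qed.

(** The formal difference of the two products is the formal difference of s and s' times t. *)
Lemma cls_mulsl s s' t : cls s = cls s' -> cls (muls s t) = cls (muls s' t).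
Proof.
by move=> /clsP ss'; apply/clsP; rewrite opps_muls -muls_catl; apply: null_muls.
Qed.

Lemma cls_muls s t : umul (cls s) (cls t) = cls (muls s t).
Proof.
rewrite /umul (cls_mulsl _ (repK (cls s))) (cls_perm (perm_mulsC _ _)).
by rewrite (cls_mulsl _ (repK (cls t))) (cls_perm (perm_mulsC _ _)).
Qed.

Definition of_pf p : uring := cls [:: p].

(** Padding the null multiset {p, -q} with 0 makes it a triple, and [null_triple] yields p + 0 =
    q. *)
Lemma of_pf_inj : injective of_pf.
Proof.
move=> p q /clsP /= pq; have /null_triple : null [:: p; pf0; pfopp q].
  apply: null_perm (null_cat pq (null0 P)).
  by rewrite perm_cons (perm_catC [:: _]).
by rewrite pfaddp0 => -[].
Qed.

Lemma of_pf0 : of_pf pf0 = cls [::].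
Proof. by apply/clsP; apply: null0. Qed.

Fact uaddA : associative uadd.
Proof.
by elim/cls_ind=> s; elim/cls_ind=> t; elim/cls_ind=> u; rewrite !cls_cat catA.
Qed.

Fact uaddC : commutative uadd.
Proof.
elim/cls_ind=> s; elim/cls_ind=> t; rewrite !cls_cat.
by apply: cls_perm; rewrite perm_catC.
Qed.

Fact uadd0 : left_id (of_pf pf0) uadd.
Proof. by elim/cls_ind=> s; rewrite of_pf0 cls_cat. Qed.

Fact uaddN : left_inverse (of_pf pf0) uopp uadd.
Proof.
elim/cls_ind=> s; rewrite uaddC of_pf0 cls_opps cls_cat.
by apply/clsP; rewrite cats0; apply: null_pairs.
Qed.

Fact umulA : associative umul.
Proof.
elim/cls_ind=> s; elim/cls_ind=> t; elim/cls_ind=> u.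
by rewrite !cls_muls mulsA.
Qed.

Fact umulC : commutative umul.
Proof.
elim/cls_ind=> s; elim/cls_ind=> t; rewrite !cls_muls.
exact/cls_perm/perm_mulsC.
Qed.

Fact umul1 : left_id (of_pf pf1) umul.
Proof.
elim/cls_ind=> s; rewrite cls_muls muls_consl cats0.
by rewrite (eq_map (@pfmul1p P)) map_id.
Qed.

Fact umulDl : left_distributive umul uadd.
Proof.
elim/cls_ind=> s; elim/cls_ind=> t; elim/cls_ind=> u.
by rewrite !(cls_cat, cls_muls) muls_catl.
Qed.

Fact uring1_neq0 : of_pf pf1 != of_pf pf0.
Proof. by rewrite (inj_eq of_pf_inj) pf1_neq0. Qed.

HB.instance Definition _ := GRing.isZmodule.Build uring uaddA uaddC uadd0 uaddN.
HB.instance Definition _ :=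
  GRing.Zmodule_isComNzRing.Build uring umulA umulC umul1 umulDl uring1_neq0.

(** Units and inverses are obtained classically; non-units are their own [uinv], the default value
    that the unit ring structure demands. *)
Definition uunit : pred uring := fun x => `[< exists y, y * x = 1 >].
Definition uinv (x : uring) : uring :=
  if pselect (exists y, y * x = 1) is left xP then projT1 (cid xP) else x.

Fact umulV : {in uunit, left_inverse 1 uinv *%R}.
Proof.
move=> x /asboolP xP; rewrite /uinv; case: pselect => // xP'.
by case: cid.
Qed.

Fact uunitP (x y : uring) : y * x = 1 -> uunit x.
Proof. by move=> yx; apply/asboolP; exists y. Qed.

Fact uinv_out : {in [predC uunit], uinv =1 id}.
Proof. by move=> x /asboolP xP; rewrite /uinv; case: pselect. Qed.

HB.instance Definition _ :=
  GRing.ComNzRing_hasMulInverse.Build uring umulV uunitP uinv_out.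

Lemma of_pfM p q : of_pf (pfmul p q) = of_pf p * of_pf q.
Proof. by rewrite [RHS]cls_muls. Qed.

Lemma of_pfD p q r : of_pf p + of_pf q = of_pf r <-> pfadd p q = Some r.
Proof.
rewrite [_ + _]cls_cat; split=> [/clsP /null_triple //|pq].
by apply/clsP; apply: null_sum.
Qed.

Lemma of_pf_unit p : p != pf0 -> of_pf p \is a GRing.unit.
Proof.
move=> /pfmulpV [q pq]; apply/unitrP; exists (of_pf q).
by rewrite -!of_pfM pfmulC pq.
Qed.

(** * The partial field recovered inside its universal ring *)

Definition nonzeros : set uring := of_pf @` [set~ pf0].

Lemma nonzeros_unit : nonzeros `<=` @units uring.
Proof. by move=> _ [p /eqP p0 <-]; apply: of_pf_unit. Qed.

(** The image of the nonzero elements is already a group containing -1, so generation adds nothing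
    and the carrier of P(R, S) is exactly the image of [P]. *)
Lemma generated_nonzeros x :
  generated 1 *%R (nonzeros `|` [set -1]) x ->
  exists2 p, p != pf0 & of_pf p = x.
Proof.
elim=> {x} [x [[p /eqP p0 <-]|->]||x y _ [p p0 <-] _
  [q q0 <-]|x y _ [p p0 <-] xy].
- by exists p.
- exists (pfopp pf1); last exact/esym/cls_opps.
  by apply: contraNneq (@pf1_neq0 P) => p0; rewrite -(pfoppK pf1) p0 pfopp0.
- by exists pf1 => //; apply: pf1_neq0.
- exists (pfmul p q); last exact: of_pfM.
  have [p' pp'] := pfmulpV p p0; apply: contraNneq q0 => pq.
  by rewrite -(pfmul1p q) -pp' (pfmulC p) -pfmulA pq pfmulp0.
- have [q pq] := pfmulpV p p0; exists q.
    by apply: contraNneq (@pf1_neq0 P) => q0; rewrite -pq q0 pfmulp0.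
  (* Both the given inverse and the image of q invert the unit [of_pf p], so they agree. *)
  by apply: (mulrI (of_pf_unit p0)); rewrite xy -of_pfM pq.
Qed.

Lemma mem_nonzeros p : of_pf p \in ringpf_set nonzeros.
Proof.
rewrite inE; have [->|p0] := eqVneq p pf0; first by right.
by left; apply: Gen_mem; left; exists p => //; apply/eqP.
Qed.

Definition embed p : ringpf nonzeros_unit :=
  RingPF nonzeros_unit (mem_nonzeros p).

Lemma embed_surj z : exists p, embed p = z.
Proof.
case: z => x xA; have := xA; rewrite inE => -[/generated_nonzeros [p _ px]|x0].
  by exists p; apply: val_inj.
by exists pf0; apply: val_inj.
Qed.

(** Definedness is reflected because a sum that lies in P(R, S) is itself the image of some r, and
    [of_pfD] then gives p + q = r in [P]. *)
Lemma embed_iso : pf_iso embed.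
Proof.
have embed_hom : pf_hom embed.
  split=> [p q|p q r pq]; first by apply: val_inj; apply: of_pfM.
  by apply/ringpf_addE/of_pfD.
split=> //.
  have [g gK] := choice embed_surj; exists g => // p.
  by apply: of_pf_inj; have /(congr1 val) := gK (embed p).
move=> p q; split.
  case pq: (pfadd _ _) => [z|//] _; have [r rz] := embed_surj z.
  move: pq; rewrite -rz => /ringpf_addE /of_pfD pq.
  by rewrite pq.
case pq: (pfadd _ _) => [r|//] _.
by rewrite (embed_hom.2 _ _ _ pq).
Qed.

End UniversalRing.

(** * Ring maps induced by homomorphisms of partial fields *)

Section Functoriality.
Variables (P Q : partialFieldType) (f : P -> Q).
Hypothesis f_hom : pf_hom f.

Definition umap (x : uring P) : uring Q := cls (map f (rep x)).

Lemma umap_cls s : umap (cls s) = cls (map f s).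
Proof.
have [_ fD] := f_hom; apply/clsP; rewrite -map_opps // -map_cat.
exact/null_map/cls_rep.
Qed.

Fact umap_zmod_morphism : zmod_morphism umap.
Proof.
have [_ fD] := f_hom; elim/cls_ind=> s; elim/cls_ind=> t.
have subE (T : partialFieldType) (u v : seq T) :
    cls u - cls v = cls (u ++ opps v).
  by rewrite -cls_cat -cls_opps.
by rewrite subE !umap_cls subE map_cat map_opps.
Qed.

Lemma umapM : {morph umap : x y / x * y}.
Proof.
have [fM _] := f_hom; elim/cls_ind=> s; elim/cls_ind=> t.
have mulE (T : partialFieldType) (u v : seq T) : cls u * cls v = cls (muls u v).
  exact: cls_muls.
rewrite mulE !umap_cls mulE /muls map_allpairs allpairs_mapl allpairs_mapr.
by congr cls; apply: eq_allpairs => x y; rewrite fM.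
Qed.

End Functoriality.

(** A nonzero value f(p) can be cancelled from f(1) f(p) = f(p). *)
Lemma pf_hom1 (P Q : partialFieldType) (f : P -> Q) :
  pf_hom f -> (exists p, f p != pf0) -> f pf1 = pf1.
Proof.
move=> [fM _] [p fp]; have [q pq] := pfmulpV _ fp.
by rewrite -pq -(pfmul1p p) fM -pfmulA pq pfmulp1.
Qed.

Theorem theorem5p3 (P P' : partialFieldType)
    (hP : fundamentally_generated P) (hP' : fundamentally_generated P')
    (phi : P -> P') (hphi : pf_hom phi) :
  exists (R R' : comUnitRingType) (S : set R) (S' : set R')
    (hS : S `<=` @units R) (hS' : S' `<=` @units R')
    (psi : P -> ringpf hS) (psi' : P' -> ringpf hS')
    (phi' : {additive R -> R'}),
    [/\ pf_iso psi, pf_iso psi',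
        {morph phi' : x y / x * y},
        (exists p, phi p != pf0) -> phi' 1 = 1 &
        forall p, phi' (ringpf_val (psi p)) = ringpf_val (psi' (phi p))].
Proof.
exists (uring P), (uring P'), (@nonzeros P), (@nonzeros P').
exists (@nonzeros_unit P), (@nonzeros_unit P'), (@embed P), (@embed P').
(* Only the additive structure is packed: for the zero homomorphism the induced map sends 1 to 0. *)
pose umap_additive := GRing.isZmodMorphism.Build (uring P) (uring P') (umap phi)
  (umap_zmod_morphism hphi).
pose phi' : {additive uring P -> uring P'} := HB.pack (umap phi) umap_additive.
exists phi'.
split; [exact: embed_iso | exact: embed_iso | exact: umapM hphi | |].
  by move=> /(pf_hom1 hphi) phi1; rewrite /= [LHS]umap_cls //= phi1.
by move=> p; rewrite /= umap_cls.
Qed.
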